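(* Let $n$ agents, agent $i$ holding a local dataset $D_i$, run $T$ iterations of the following perturbed decentralized SGD: at iteration $t$, each agent $i$ computes a stochastic gradient $g_i^{(t)}$ of its local loss on $D_i$ at its current parameter $\tilde x_i^{(t)}$, clips it as $\hat g_i^{(t)}=\min\{1,C/|g_i^{(t)}|\}\,g_i^{(t)}$ with threshold $C>0$, and the perturbed gradient vector is $\tilde{\mathbf{g}}^{(t)}=\hat{\mathbf{g}}^{(t)}+\mathbf{v}^{(t)}$ with $\mathbf{v}^{(t)}\sim\mathcal{N}(\mathbf{0},\mathbf{R})$ drawn afresh each iteration, where $\mathbf{R}\in\mathbb{R}^{n\times n}$ is positive definite ($\mathbf{R}\succ0$); the models are then updated as $\tilde{\mathbf{x}}^{(t+1)}=\mathbf{W}(\tilde{\mathbf{x}}^{(t)}-\eta_t\tilde{\mathbf{g}}^{(t)})$ for a mixing matrix $\mathbf{W}$ and step sizes $\eta_t$. Then, for any $\delta\in(0,1)$, this mechanism (whose output is the perturbed local models $\tilde{\mathbf{x}}^{(t)}$ shared over the $T$ iterations) is agent-level $(\varepsilon,\delta)$-differentially private with $$\varepsilon\le 2C^2T\max_{i}[\mathbf{R}^{-1}]_{ii}+2C\sqrt{2T\log(1/\delta)\max_{i}[\mathbf{R}^{-1}]_{ii}}.$$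
   Context: Two collections of datasets $D=\{D_1,\dots,D_n\}$ and $D'=\{D'_1,\dots,D'_n\}$ are agent-level neighbors if there is exactly one $j$ with $D_j\ne D'_j$ and $D_i=D'_i$ for all $i\ne j$. A randomized mechanism $M$ is agent-level $(\varepsilon,\delta)$-differentially private if for all agent-level neighboring $D,D'$ and all measurable output sets $S$, $\Pr[M(D)\in S]\le e^{\varepsilon}\Pr[M(D')\in S]+\delta$. Here $\max_i$ ranges over the agents $i\in\{1,\dots,n\}$ and $\log$ is the natural logarithm. *)

(* Defs.v *)
From HB Require Import structures.
From mathcomp Require Import all_boot all_order all_algebra.
From mathcomp Require Import all_classical all_reals all_analysis.

Set Implicit Arguments.
Unset Strict Implicit.
Unset Printing Implicit Defensive.

Import Order.TTheory GRing.Theory Num.Theory.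
Import numFieldNormedType.Exports.
Local Open Scope classical_set_scope.
Local Open Scope ring_scope.

Section DPDSGD.
Variable R : realType.

Fixpoint tint (X : Type) (I : (X -> \bar R) -> \bar R) (N : nat)
  : (N.-tuple X -> \bar R) -> \bar R :=
  match N return (N.-tuple X -> \bar R) -> \bar R with
  | 0 => fun F => F [tuple]
  | N'.+1 => fun F => I (fun x => @tint X I N' (fun t => F (cons_tuple x t)))
  end.
Arguments tint : clear implicits.

Definition Ileb (f : R -> \bar R) : \bar R :=
  (\int[@lebesgue_measure R]_x f x)%E.

Definition cv_of_tuple n (u : n.-tuple R) : 'cV[R]_n := \col_i tnth u i.
Definition rv_of_tuple d (u : d.-tuple R) : 'rV[R]_d := \row_k tnth u k.
Definition tuple_of_rv d (g : 'rV[R]_d) : d.-tuple R := [tuple g 0 k | k < d].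
Definition tuple_of_mx n d (x : 'M[R]_(n, d)) : n.-tuple (d.-tuple R) :=
  [tuple [tuple x i k | k < d] | i < n].

Definition posdef n (Rm : 'M[R]_n) : Prop :=
  Rm^T = Rm /\ forall u : 'cV[R]_n, u != 0 -> 0 < (u^T *m Rm *m u) 0 0.

Definition gauss_pdf n (Rm : 'M[R]_n) (u : n.-tuple R) : R :=
  (Num.sqrt ((pi *+ 2) ^+ n * \det Rm))^-1 *
  expR (- (((cv_of_tuple u)^T *m invmx Rm *m cv_of_tuple u) 0 0) / 2).

Definition Igauss n (Rm : 'M[R]_n) (f : n.-tuple R -> \bar R) : \bar R :=
  tint _ Ileb n (fun u => (f u * (gauss_pdf Rm u)%:E)%E).

Definition enorm d (g : 'rV[R]_d) : R := Num.sqrt (\sum_(k < d) g 0 k ^+ 2).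

Definition clip (C : R) d (g : 'rV[R]_d) : 'rV[R]_d :=
  Num.min 1 (C / enorm g) *: g.

(* Noise of one iteration: d columns, each an n-vector (one entry per agent). *)
Definition noise_mx n d (v : d.-tuple (n.-tuple R)) : 'M[R]_(n, d) :=
  \matrix_(i, k) tnth (tnth v k) i.

Definition noise0 n d : d.-tuple (n.-tuple R) := [tuple [tuple 0 | _ < n] | _ < d].

Section Mechanism.
Variables (n d T : nat) (Data : Type).
Variables (Xi : Type).
(* grad t i Di xi x : stochastic gradient of agent i's local loss on its
   dataset Di at parameter x, at iteration t, with sampling randomness xi. *)
Variable grad : nat -> 'I_n -> Data -> Xi -> 'rV[R]_d -> 'rV[R]_d.
Variables (C : R) (W : 'M[R]_n) (eta : nat -> R) (x0 : 'M[R]_(n, d)).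

Definition dsgd_step (D : 'I_n -> Data) (xi : Xi) (t : nat)
  (x : 'M[R]_(n, d)) (v : 'M[R]_(n, d)) : 'M[R]_(n, d) :=
  let ghat := \matrix_(i, k) clip C (grad t i (D i) xi (row i x)) 0 k in
  W *m (x - eta t *: (ghat + v)).

Fixpoint dsgd_state (D : 'I_n -> Data) (xi : Xi)
  (z : T.-tuple (d.-tuple (n.-tuple R))) (t : nat) : 'M[R]_(n, d) :=
  match t with
  | 0 => x0
  | t'.+1 => dsgd_step D xi t' (dsgd_state D xi z t')
                        (noise_mx (nth (noise0 n d) z t'))
  end.

Definition dsgd_output (D : 'I_n -> Data) (xi : Xi)
  (z : T.-tuple (d.-tuple (n.-tuple R))) : T.-tuple (n.-tuple (d.-tuple R)) :=
  [tuple tuple_of_mx (dsgd_state D xi z t.+1) | t < T].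
End Mechanism.

(* Pr[M(D) ∈ S] : sampling randomness xi ~ P, independent noises
   v^(t) whose d columns are i.i.d. N(0, Rm), independent over t. *)
Definition dsgd_prob n d T (Data : Type) (dx : measure_display)
  (Xi : measurableType dx) (P : probability Xi R)
  (grad : nat -> 'I_n -> Data -> Xi -> 'rV[R]_d -> 'rV[R]_d)
  (C : R) (W : 'M[R]_n) (eta : nat -> R) (x0 : 'M[R]_(n, d)) (Rm : 'M[R]_n)
  (D : 'I_n -> Data) (S : set (T.-tuple (n.-tuple (d.-tuple R)))) : \bar R :=
  (\int[P]_xi
     tint _ (tint _ (Igauss Rm) d) T
       (fun z => (\1_S (dsgd_output grad C W eta x0 D xi z))%:E))%E.

Definition agent_neighbors n (Data : Type) (D D' : 'I_n -> Data) : Prop :=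
  exists j : 'I_n, D j <> D' j /\ forall i : 'I_n, i <> j -> D i = D' i.

Definition agent_level_DP n (Data : Type) (dO : measure_display)
  (OutM : measurableType dO) (Pr : ('I_n -> Data) -> set OutM -> \bar R)
  (eps delta : R) : Prop :=
  forall (D D' : 'I_n -> Data), agent_neighbors D D' ->
  forall S : set OutM, measurable S ->
  (Pr D S <= (expR eps)%:E * Pr D' S + delta%:E)%E.

Definition max_diag_inv n (Rm : 'M[R]_n) : R :=
  \big[Num.max/0]_(i < n) invmx Rm i i.

End DPDSGD.

(* Main.v *)
Require Import Defs.
From HB Require Import structures.
From mathcomp Require Import all_boot all_order all_algebra.
From mathcomp Require Import all_classical all_reals all_analysis measurable_realfun.
From mathcomp Require Import ring lra.
Import Order.TTheory GRing.Theory Num.Theory.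
Local Open Scope classical_set_scope.
Local Open Scope ring_scope.

Set Implicit Arguments.
Unset Strict Implicit.
Unset Printing Implicit Defensive.

(** Fix the sampling randomness and two neighbors that differ only at agent [j]. As long as the two
    runs are in the same state, switching the dataset changes only row [j] of the clipped gradient
    matrix, and adding that gap to the noise of the second run makes both runs take the same step
    ([dsgd_step_gap]). So a run on [D] with noise [v] coincides with a run on [D'] with noise
    shifted, at each iteration, by a quantity determined by the past ([coupled_dsgd]).

    Each shift is paid for by a Gaussian likelihood ratio. It has columns proportional to the [j]-th
    basis vector, and clipping bounds the norm of the gap by [2 * C], so its squared length in the
    metric of [invmx Rm] is at most [4 * C ^+ 2 * invmx Rm j j] ([noise_cost_gap]). The moment of
    order [l] of the privacy loss of one iteration is then at most the exponential of
    [(l + l ^+ 2) / 2] times this bound ([noise_integral_moment]).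

    A Chernoff argument over the iterations ([coupled_le]) gives additive error
    [expR (- l * eps + rho * (l + l ^+ 2))] with [rho = 2 * C ^+ 2 * T%:R * max_diag_inv Rm]. The
    best [l] makes this error equal to [delta] at the stated [eps] ([chernoff_exponent]), and
    integrating over the sampling randomness preserves the inequality. *)

(** * Abstract integrals and their iteration *)

Section IsIntegral.
Context {R : realType}.
Local Open Scope ereal_scope.

                                                                             
                                                                                
                    
(** Probabilities here are iterated integrals rather than integrals against a product measure. These
    properties suffice for the whole argument and survive both iteration and multiplication by a
    density. The last one, measurability in a parameter, is what lets an inner integral be
    integrated again. *)
Record is_integral d (X : measurableType d) (I : (X -> \bar R) -> \bar R) :
    Prop := IsIntegral {
  is_integral_ge0 : forall f : X -> \bar R, (forall x, 0 <= f x) -> 0 <= I f;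
  is_integral_le : forall f g : X -> \bar R,
    measurable_fun setT f -> measurable_fun setT g ->
    (forall x, 0 <= f x) -> (forall x, f x <= g x) -> I f <= I g;
  is_integralD : forall f g : X -> \bar R,
    measurable_fun setT f -> measurable_fun setT g ->
    (forall x, 0 <= f x) -> (forall x, 0 <= g x) ->
    I (fun x => f x + g x) = I f + I g;
  is_integralZ : forall (c : R) (f : X -> \bar R), (0 <= c)%R ->
    measurable_fun setT f -> (forall x, 0 <= f x) ->
    I (fun x => c%:E * f x) = c%:E * I f;
  measurable_is_integral : forall dY (Y : measurableType dY)
      (f : Y * X -> \bar R),
    measurable_fun setT f -> (forall p, 0 <= f p) ->
    measurable_fun setT (fun y => I (fun x => f (y, x))) }.

Lemma is_integral_Ileb : is_integral (@Ileb R : (R -> \bar R) -> _).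
Proof.
split=> [f f0|f g mf mg f0 fg|f g mf mg f0 g0|c f c0 mf f0|dY Y f mf f0].
- exact: integral_ge0.
- exact: ge0_le_integral.
- exact: ge0_integralD.
- exact: ge0_integralZl_EFin.
- exact: (measurable_fun_fubini_tonelli_F (m2 := @lebesgue_measure R)).
Qed.

Section tint_integral.
Context d (X : measurableType d) (I : (X -> \bar R) -> \bar R).
Hypothesis II : is_integral I.

Lemma measurable_comp_cons dY (Y : measurableType dY) N
    (f : Y * N.+1.-tuple X -> \bar R) :
  measurable_fun setT f ->
  measurable_fun setT (fun p : Y * X * N.-tuple X =>
    f (p.1.1, cons_tuple p.1.2 p.2)).
Proof.
move=> mf; apply: (measurableT_comp mf); apply: measurable_fun_pair => /=.
  exact: measurableT_comp.
by apply: measurable_cons => //; exact: measurableT_comp.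
Qed.

Lemma measurable_comp_cons1 N (f : N.+1.-tuple X -> \bar R) x :
  measurable_fun setT f ->
  measurable_fun setT (fun t : N.-tuple X => f (cons_tuple x t)).
Proof.
by move=> mf; apply: (measurableT_comp mf); apply: measurable_cons.
Qed.

Lemma measurable_tint_cons N (f : N.+1.-tuple X -> \bar R) :
  is_integral (@tint R X I N) ->
  measurable_fun setT f -> (forall x, 0 <= f x) ->
  measurable_fun setT (fun x => @tint R X I N (fun t => f (cons_tuple x t))).
Proof.
move=> IH mf f0.
apply: (measurable_is_integral IH (f := fun p => f (cons_tuple p.1 p.2))) => //.
by apply: (measurableT_comp mf); exact: measurable_cons.
Qed.

Lemma is_integral_tint N : is_integral (@tint R X I N).
Proof.
elim: N => [|N IH].
  split=> //= dY Y f mf f0; apply: (measurableT_comp mf).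
  exact: measurable_fun_pair.
split=> [f f0|f g mf mg f0 fg|f g mf mg f0 g0|c f c0 mf f0|dY Y f mf f0] /=.
- by apply: is_integral_ge0 => // x; exact: is_integral_ge0.
- apply: is_integral_le => // [||x|x].
  + exact: measurable_tint_cons.
  + by apply: measurable_tint_cons => // x; exact: le_trans (fg x).
  + exact: is_integral_ge0.
  + by apply: is_integral_le => //; exact: measurable_comp_cons1.
- rewrite -is_integralD//.
  + congr I; apply/funext => x.
    by rewrite is_integralD//; exact: measurable_comp_cons1.
  + exact: measurable_tint_cons.
  + exact: measurable_tint_cons.
  + by move=> x; exact: is_integral_ge0.
  + by move=> x; exact: is_integral_ge0.
- rewrite -is_integralZ//.
  + congr I; apply/funext => x.
    by rewrite is_integralZ//; exact: measurable_comp_cons1.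
  + exact: measurable_tint_cons.
  + by move=> x; exact: is_integral_ge0.
(* The head variable joins the parameter: the induction hypothesis is used with parameter space
   [Y * X], then the outer integral removes [X]. *)
- apply: (measurable_is_integral II (f := fun p : Y * X =>
    @tint R X I N (fun t => f (p.1, cons_tuple p.2 t)))).
    apply: (measurable_is_integral IH
      (f := fun p : Y * X * N.-tuple X => f (p.1.1, cons_tuple p.1.2 p.2))) => //.
    exact: measurable_comp_cons.
  by move=> p; exact: is_integral_ge0.
Qed.
End tint_integral.

Lemma is_integral_density d (X : measurableType d)
    (I : (X -> \bar R) -> \bar R) (h : X -> R) :
  is_integral I -> measurable_fun setT h -> (forall x, 0 <= h x)%R ->
  is_integral (fun f => I (fun x => f x * (h x)%:E)).
Proof.
move=> II mh h0.
have mH : measurable_fun setT (EFin \o h) by exact/measurable_EFinP.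
have H0 x : 0 <= (h x)%:E by rewrite lee_fin.
split=> [f f0|f g mf mg f0 fg|f g mf mg f0 g0|c f c0 mf f0|dY Y f mf f0] /=.
- by apply: is_integral_ge0 => // x; exact: mule_ge0.
- apply: is_integral_le => // [||x|x].
  + exact: emeasurable_funM.
  + exact: emeasurable_funM.
  + exact: mule_ge0.
  + by rewrite lee_wpmul2r.
- rewrite -is_integralD//.
  + by congr I; apply/funext => x; rewrite ge0_muleDl.
  + exact: emeasurable_funM.
  + exact: emeasurable_funM.
  + by move=> x; exact: mule_ge0.
  + by move=> x; exact: mule_ge0.
- rewrite -is_integralZ//.
  + by congr I; apply/funext => x; rewrite muleA.
  + exact: emeasurable_funM.
  + by move=> x; exact: mule_ge0.
- apply: (measurable_is_integral II (f := fun p : Y * X => f p * (h p.2)%:E)).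
    apply: emeasurable_funM => //.
    exact: (measurableT_comp mH).
  by move=> p; exact: mule_ge0.
Qed.

End IsIntegral.

(** * Change of variables by translation *)

Section Shift.
Context {R : realType}.
Local Open Scope ereal_scope.

Definition tuple_shift (A X Y : Type) (sh : A -> X -> Y) N (a : N.-tuple A)
  (t : N.-tuple X) : N.-tuple Y := [tuple sh (tnth a i) (tnth t i) | i < N].

Lemma tuple_shift_cons (A X Y : Type) (sh : A -> X -> Y) N (a : N.+1.-tuple A)
    x (t : N.-tuple X) :
  tuple_shift sh a (cons_tuple x t) =
  cons_tuple (sh (thead a) x) (tuple_shift sh (behead_tuple a) t).
Proof.
apply: eq_from_tnth => i; rewrite tnth_mktuple.
case: (unliftP ord0 i) => [j ->|->]; last by rewrite !tnth0.
by rewrite !tnthS tnth_mktuple tnth_behead -lift0 inord_val.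
Qed.

Lemma measurable_tuple_shift (A : Type) d1 (X : measurableType d1)
    d2 (Y : measurableType d2) (sh : A -> X -> Y)
    N (a : N.-tuple A) :
  (forall b, measurable_fun setT (sh b)) -> measurable_fun setT (tuple_shift sh a).
Proof.
move=> msh; apply/measurable_fun_tnthP => i.
rewrite (_ : _ \o _ = sh (tnth a i) \o (fun t => tnth t i)).
  by apply: measurableT_comp => //; exact: measurable_tnth.
by apply/funext => t /=; rewrite tnth_mktuple.
Qed.

                                                                                  
(** If the one-variable integral absorbs [sh a] against the weight [w a], the iterated one absorbs
    the coordinatewise map against the product of the weights, by peeling off the head. It serves
    twice: with weight 1 for Lebesgue integrals, and with likelihood ratios for the noise
    columns. *)
Lemma tint_shift (A : Type) d (X : measurableType d)
    (I : (X -> \bar R) -> \bar R) (sh : A -> X -> X) (w : A -> X -> R) :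
  is_integral I ->
  (forall a, measurable_fun setT (sh a)) ->
  (forall a, measurable_fun setT (w a)) ->
  (forall a x, (0 <= w a x)%R) ->
  (forall a (f : X -> \bar R), measurable_fun setT f -> (forall x, 0 <= f x) ->
    I (fun x => (w a x)%:E * f (sh a x)) = I f) ->
  forall N (a : N.-tuple A) (f : N.-tuple X -> \bar R),
    measurable_fun setT f -> (forall x, 0 <= f x) ->
    tint I (fun t => (\prod_(i < N) w (tnth a i) (tnth t i))%:E *
      f (tuple_shift sh a t)) = tint I f.
Proof.
move=> II msh mw w0 Ish; elim=> [a f mf f0|N IH a f mf f0].
  by rewrite /= big_ord0 mul1e; congr f; apply: eq_from_tnth; case.
pose G x := tint I (fun t : N.-tuple X => f (cons_tuple x t)).
rewrite -[RHS](Ish (thead a) G); last 2 first.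
- exact: (measurable_tint_cons (is_integral_tint II N)).
- by move=> x; apply: (is_integral_ge0 (is_integral_tint II N)).
congr I; apply/funext => x.
pose sx := sh (thead a) x.
rewrite -/(tint I _) /G -(IH (behead_tuple a) (fun t => f (cons_tuple sx t)));
  last 2 first.
- exact: measurable_comp_cons1.
- by [].
rewrite -(is_integralZ (is_integral_tint II N))//.
- congr tint; apply/funext => t; rewrite tuple_shift_cons big_ord_recl EFinM muleA.
  rewrite !tnth0; congr (_ * _%:E * _); apply: eq_bigr => i _.
  by rewrite tnthS tnth_behead -lift0 inord_val.
- apply: emeasurable_funM.
    apply/measurable_EFinP; apply: measurable_prod => i _.
    by apply: measurableT_comp => //; exact: measurable_tnth.
  apply: (measurableT_comp (measurable_comp_cons1 sx mf)).
  exact: measurable_tuple_shift.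
- by move=> t; rewrite mule_ge0// lee_fin prodr_ge0.
Qed.

(** The image of Lebesgue measure under a translation gives left-open right-closed intervals their
    length, hence is Lebesgue measure by uniqueness. *)
Lemma Ileb_shift (a : R) (f : R -> \bar R) :
  measurable_fun setT f -> (forall x, 0 <= f x) ->
  Ileb (fun x => f (x + a)%R) = Ileb f.
Proof.
move=> mf f0; rewrite /Ileb.
pose phi : measurableTypeR R -> measurableTypeR R := fun x => (x + a)%R.
have mphi : measurable_fun setT phi by exact: measurable_funD.
transitivity (\int[pushforward lebesgue_measure phi]_x f x).
  by rewrite ge0_integral_pushforward.
apply: eq_measure_integral => A mA _.
apply/esym/lebesgue_measure_unique => //= _ [[b c]] _ <-.
rewrite /=; transitivity (lebesgue_measure `](b - a)%R, (c - a)%R]%classic); last first.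
  congr lebesgue_measure; apply/seteqP; split => x.
    by rewrite /= !in_itv/= ltrBlDr lerBrDr.
  by rewrite /= !in_itv/= ltrBlDr lerBrDr.
rewrite !lebesgue_measure_itv/= !lte_fin ltrD2r.
by case: ifP => // _; congr _%:E; rewrite opprD opprK addrACA addNr addr0.
Qed.

Definition tuple_add N (a u : N.-tuple R) : N.-tuple R :=
  tuple_shift (fun b x : R => x + b)%R a u.

Lemma measurable_tuple_add n (a : n.-tuple R) : measurable_fun setT (tuple_add a).
Proof.
apply: measurable_tuple_shift => b.
exact: measurable_funD.
Qed.

Lemma tint_Ileb_add n (a : n.-tuple R) (f : n.-tuple R -> \bar R) :
  measurable_fun setT f -> (forall x, 0 <= f x) ->
  tint (@Ileb R) (fun u => f (tuple_add a u)) = tint (@Ileb R) f.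
Proof.
move=> mf f0.
rewrite -[RHS](tint_shift (I := @Ileb R) (sh := fun b x : R => (x + b)%R)
   (w := fun=> fun=> 1%R) _ _ _ _ _ a mf f0) //.
- by congr tint; apply/funext => u; rewrite big1// mul1e.
- exact: is_integral_Ileb.
- by move=> b; exact: measurable_funD.
- by move=> b g mg g0; under eq_fun do rewrite mul1e; exact: Ileb_shift.
Qed.

End Shift.

(** * Quadratic forms, Schur complements and positive definiteness *)

Section QuadraticForm.
Context {R : realType}.
Implicit Types n : nat.

Definition qform n (Q : 'M[R]_n) (x : 'cV[R]_n) : R := (x^T *m Q *m x) 0 0.

Lemma qform_sum n (Q : 'M[R]_n) x :
  qform Q x = \sum_j (\sum_i x i 0 * Q i j) * x j 0.
Proof.
rewrite /qform mxE; apply: eq_bigr => j _; rewrite mxE; congr (_ * _).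
by apply: eq_bigr => i _; rewrite mxE.
Qed.

Lemma measurable_qform n (Q : 'M[R]_n) :
  measurable_fun [set: n.-tuple R] (fun u => qform Q (cv_of_tuple u)).
Proof.
under eq_fun do rewrite qform_sum.
have mu (j : 'I_n) : measurable_fun [set: n.-tuple R]
    (fun u => cv_of_tuple u j 0).
  by under eq_fun do rewrite mxE; exact: measurable_tnth.
apply: measurable_sum => j; apply: measurable_funM => //.
by apply: measurable_sum => i; exact: measurable_funM.
Qed.

Lemma measurable_expR_qform n (Q : 'M[R]_n) :
  measurable_fun [set: n.-tuple R]
    (fun u => (expR (- qform Q (cv_of_tuple u) / 2))%:E).
Proof.
apply/measurable_EFinP; apply: measurableT_comp => //.
by apply: measurable_funM => //; apply: measurable_funN; exact: measurable_qform.
Qed.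

Lemma qform0 n (Q : 'M[R]_n) : qform Q 0 = 0.
Proof. by rewrite /qform mulmx0 mxE. Qed.

Lemma qformZ n (Q : 'M[R]_n) k (x : 'cV[R]_n) : qform Q (k *: x) = k ^+ 2 * qform Q x.
Proof.
have trZ : (k *: x)^T = k *: x^T by exact: linearZ.
by rewrite /qform trZ -!scalemxAl -scalemxAr scalerA mxE expr2.
Qed.

Lemma qformD n (Q : 'M[R]_n) (x y : 'cV[R]_n) : Q^T = Q ->
  qform Q (x + y) = qform Q x + 2 * (x^T *m Q *m y) 0 0 + qform Q y.
Proof.
move=> Qsym; have E : (y^T *m Q *m x) 0 0 = (x^T *m Q *m y) 0 0.
  have -> : x^T *m Q *m y = (y^T *m Q *m x)^T.
    by rewrite !trmx_mul trmxK Qsym mulmxA.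
  by rewrite [RHS]mxE.
have trD : (x + y)^T = x^T + y^T by exact: raddfD.
rewrite /qform trD !mulmxDl !mulmxDr.
rewrite [LHS]mxE [X in X + _]mxE [X in _ + X]mxE E.
by ring.
Qed.

Lemma qform_delta n (Q : 'M[R]_n) i k :
  qform Q (k *: delta_mx i 0) = k ^+ 2 * Q i i.
Proof.
by rewrite qformZ /qform trmx_delta -rowE -colE !mxE.
Qed.

Lemma posdef_sym n (Q : 'M[R]_n) : posdef Q -> Q^T = Q.
Proof. by case. Qed.

Lemma posdef_qform_gt0 n (Q : 'M[R]_n) x : posdef Q -> x != 0 -> 0 < qform Q x.
Proof. by case=> _; exact. Qed.

Section Schur.
Variables (n : nat) (Q : 'M[R]_(1 + n)).
Hypothesis Qsym : Q^T = Q.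

(** Up to sign and the factor [x], the centre of the square completed in the last [n] variables; see
    [qform_schur]. *)
Definition schur_vec : 'cV[R]_n := invmx (drsubmx Q) *m dlsubmx Q.
Definition schur : R := (ulsubmx Q - ursubmx Q *m schur_vec) 0 0.

Let trdl : (dlsubmx Q)^T = ursubmx Q.
Proof. by rewrite trmx_dlsub Qsym. Qed.

Hypothesis unitQ' : drsubmx Q \in unitmx.

Let Qc : drsubmx Q *m schur_vec = dlsubmx Q.
Proof. by rewrite /schur_vec mulKVmx. Qed.

(** Multiplying on the right by a unipotent block lower triangular matrix clears the lower left
    block and puts the Schur complement in the upper left one. *)
Lemma det_schur : \det Q = schur * \det (drsubmx Q).
Proof.
have : \det (Q *m block_mx 1%:M 0 (- schur_vec) 1%:M) =
   schur * \det (drsubmx Q).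
  rewrite -{1}[Q]submxK mulmx_block !mulmx1 !mulmx0 !mulmxN Qc !add0r.
  rewrite subrr det_ublock; congr (_ * _).
  by rewrite det_mx11.
by rewrite det_mulmx det_lblock !det1 !mulr1.
Qed.

(** Completing the square in [t]: after a translation of [t] the first variable decouples from the
    others. *)
Lemma qform_schur x (t : 'cV[R]_n) :
  qform Q (col_mx x%:M t) =
  schur * x ^+ 2 + qform (drsubmx Q) (t + x *: schur_vec).
Proof.
have Q'sym : (drsubmx Q)^T = drsubmx Q by rewrite trmx_drsub Qsym.
rewrite qformD// qformZ.
have -> : t^T *m drsubmx Q *m (x *: schur_vec) = x *: (t^T *m dlsubmx Q).
  by rewrite -scalemxAr -mulmxA Qc.
have -> : qform (drsubmx Q) schur_vec = (ursubmx Q *m schur_vec) 0 0.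
  by rewrite /qform -{1}Q'sym -trmx_mul Qc trdl.
have E : (ursubmx Q *m t) 0 0 = (t^T *m dlsubmx Q) 0 0.
  by rewrite -trdl -[t in LHS]trmxK -trmx_mul mxE.
rewrite /qform -{1}[Q]submxK tr_col_mx mul_row_block mul_row_col.
rewrite tr_scalar_mx !mulmxDl !mul_scalar_mx -!mulmxA !mul_mx_scalar.
rewrite /schur -!scalemxAl -!scalemxAr.
have eD (A B : 'M[R]_1) : (A + B) 0 0 = A 0 0 + B 0 0 by rewrite mxE.
have eN (A : 'M[R]_1) : (- A) 0 0 = - A 0 0 by rewrite mxE.
have eZ k (A : 'M[R]_1) : (k *: A) 0 0 = k * A 0 0 by rewrite mxE.
rewrite !(eD, eN, eZ) E.
by ring.
Qed.

End Schur.

Lemma posdef_drsub n (Q : 'M[R]_(1 + n)) : posdef Q -> posdef (drsubmx Q).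
Proof.
move=> [Qsym Qpos]; split=> [|u u0]; first by rewrite trmx_drsub Qsym.
have := Qpos (col_mx 0 u); rewrite -{1}[Q]submxK tr_col_mx mul_row_block.
rewrite mul_row_col trmx0 !mul0mx !add0r mulmx0 add0r; apply.
by rewrite col_mx_eq0 negb_and u0 orbT.
Qed.

(** At the nonzero vector with head 1 and tail [- schur_vec Q] the completed square vanishes, so the
    form takes the value [schur Q] there. *)
Lemma posdef_schur_gt0 n (Q : 'M[R]_(1 + n)) :
  posdef Q -> drsubmx Q \in unitmx -> 0 < schur Q.
Proof.
move=> pQ uQ'.
have := posdef_qform_gt0 (x := col_mx 1%:M (- schur_vec Q)) pQ.
rewrite qform_schur ?posdef_sym// expr1n mulr1 scale1r addNr qform0 addr0.
by apply; rewrite col_mx_eq0 negb_and oner_neq0.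
Qed.

Lemma posdef_det_gt0 n (Q : 'M[R]_n) : posdef Q -> 0 < \det Q.
Proof.
elim: n => [|n IH] in Q * => pQ; first by rewrite det_mx00.
have Q'0 := IH _ (@posdef_drsub n Q pQ).
have uQ' : @drsubmx R 1 n 1 n Q \in unitmx by rewrite unitmxE unitf_gt0.
by rewrite (@det_schur n Q)// mulr_gt0// posdef_schur_gt0.
Qed.

Lemma posdef_unit n (Q : 'M[R]_n) : posdef Q -> Q \in unitmx.
Proof. by move=> /posdef_det_gt0 ?; rewrite unitmxE unitf_gt0. Qed.

Lemma posdef_invmx n (Q : 'M[R]_n) : posdef Q -> posdef (invmx Q).
Proof.
move=> pQ; have uQ := posdef_unit pQ; have [Qsym Qpos] := pQ.
split=> [|u u0]; first by rewrite trmx_inv Qsym.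
have -> : u^T *m invmx Q *m u = (invmx Q *m u)^T *m Q *m (invmx Q *m u).
  by rewrite trmx_mul trmx_inv Qsym -!mulmxA mulKVmx.
apply: Qpos; apply: contra u0 => /eqP E.
by rewrite -(mulKVmx uQ u) E mulmx0.
Qed.

Lemma posdef_diag_gt0 n (Q : 'M[R]_n) i : posdef Q -> 0 < Q i i.
Proof.
move=> pQ; have := posdef_qform_gt0 (x := 1 *: delta_mx i 0) pQ.
rewrite qform_delta expr1n mul1r scale1r; apply.
by apply/eqP => /matrixP/(_ i 0); rewrite !mxE !eqxx => /eqP; rewrite oner_eq0.
Qed.

End QuadraticForm.

(** * The multivariate Gaussian integral *)

Section GaussianIntegral.
Context {R : realType}.

Lemma cv_of_tuple_add n (a u : n.-tuple R) :
  cv_of_tuple (tuple_add a u) = cv_of_tuple u + cv_of_tuple a.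
Proof. by apply/colP => i; rewrite !mxE tnth_mktuple. Qed.

Lemma cv_of_tuple_cons n x (t : n.-tuple R) :
  cv_of_tuple (cons_tuple x t) = col_mx x%:M (cv_of_tuple t) :> 'cV[R]_(1 + n).
Proof.
apply/colP => i; rewrite -[i]splitK; case: (fintype.split i) => j /=.
  have E : lshift n j = ord0 :> 'I_n.+1 by apply: val_inj; rewrite /= ord1.
  by rewrite col_mxEu !mxE (ord1 j) eqxx mulr1n -(ord1 j) E tnth0.
have E : rshift 1 j = lift ord0 j :> 'I_n.+1 by apply: val_inj.
by rewrite col_mxEd !mxE E tnthS.
Qed.

Lemma Ileb_gauss (s : R) : 0 < s ->
  Ileb (fun x : R => (expR (- (s * x ^+ 2) / 2))%:E) =
  (Num.sqrt (pi *+ 2 / s))%:E.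
Proof.
move=> s0; pose sg := Num.sqrt s^-1.
have sg2 : sg ^+ 2 = s^-1 by rewrite sqr_sqrtr// invr_ge0 ltW.
have sg0 : sg != 0 by rewrite gt_eqF// sqrtr_gt0 invr_gt0.
have pk0 := normal_peak_gt0 sg0.
rewrite /Ileb; transitivity (\int[@lebesgue_measure R]_x
    ((normal_peak sg)^-1%:E * (normal_pdf 0 sg x)%:E))%E.
  apply: eq_integral => x _; rewrite normal_pdfE// -EFinM mulKf ?gt_eqF//.
  congr (expR _)%:E; rewrite subr0 sg2; field.
  by rewrite gt_eqF.
rewrite ge0_integralZl_EFin//.
- by rewrite integral_normal_pdf mule1 invrK sg2 -mulrnAr mulrC.
- by move=> x _; rewrite lee_fin normal_pdf_ge0.
- by apply/measurable_EFinP; exact: measurable_normal_pdf.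
- by rewrite invr_ge0 ltW.
Qed.

(** Induction on the dimension. For a fixed head, completing the square and translating the tail
    leaves the lower-dimensional integral times a one-variable Gaussian factor of precision
    [schur Q]; [det_schur] recombines the constants. *)
Lemma tint_gauss n (Q : 'M[R]_n) : posdef Q ->
  tint (@Ileb R) (fun u => (expR (- qform Q (cv_of_tuple u) / 2))%:E) =
  (Num.sqrt ((pi *+ 2) ^+ n / \det Q))%:E.
Proof.
elim: n => [|n IH] in Q * => pQ.
  by rewrite /= qform_sum big_ord0 oppr0 mul0r expR0 det_mx00 expr0 divr1 sqrtr1.
have pQ' := @posdef_drsub R n Q pQ.
have uQ' := posdef_unit pQ'.
have s0 := @posdef_schur_gt0 R n Q pQ uQ'.
have K0 : 0 <= (pi *+ 2) ^+ n / \det (@drsubmx R 1 n 1 n Q).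
  rewrite divr_ge0 ?exprn_ge0//; first by rewrite mulrn_wge0// pi_ge0.
  by rewrite ltW// posdef_det_gt0.
set K := _ / _ in K0.
rewrite (@det_schur R n Q) ?posdef_sym//=.
transitivity (Ileb (fun x : R =>
    (Num.sqrt K)%:E * (expR (- (@schur R n Q * x ^+ 2) / 2))%:E)%E).
  congr Ileb; apply/funext => x; rewrite muleC -(IH _ pQ').
  pose a : n.-tuple R := [tuple x * @schur_vec R n Q i 0 | i < n].
  pose E (u : n.-tuple R) : \bar R :=
    (expR (- qform (@drsubmx R 1 n 1 n Q) (cv_of_tuple u) / 2))%:E.
  have mE0 : measurable_fun [set: n.-tuple R] E by exact: measurable_expR_qform.
  have E0 u : (0 <= E u)%E by rewrite lee_fin expR_ge0.
  have mE : measurable_fun [set: n.-tuple R] (fun u => E (tuple_add a u)).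
    by apply: (@measurableT_comp _ _ _ _ _ _ E); [|exact: measurable_tuple_add].
  rewrite -/E -(tint_Ileb_add a mE0 E0).
  rewrite -(is_integralZ (is_integral_tint is_integral_Ileb n) _ mE); last 2 first.
  - exact: expR_ge0.
  - by move=> u; exact: E0.
  congr tint; apply/funext => t.
  rewrite (cv_of_tuple_cons x t) (@qform_schur R n Q) ?posdef_sym//.
  rewrite /E -EFinM -expRD cv_of_tuple_add; congr (expR _)%:E.
  have -> : cv_of_tuple a =
     x *: @schur_vec R n Q by apply/colP => i; rewrite mxE [RHS]mxE tnth_mktuple.
  by rewrite -mulrDl opprD.
rewrite (is_integralZ is_integral_Ileb); last 3 first.
- exact: sqrtr_ge0.
- apply/measurable_EFinP; apply: measurableT_comp => //.
  apply: measurable_funM => //; apply: measurable_funN.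
  by apply: measurable_funM => //; exact: measurable_funX.
- by move=> x; rewrite lee_fin expR_ge0.
rewrite Ileb_gauss// -EFinM -sqrtrM//; congr (Num.sqrt _)%:E.
rewrite /K exprS; field.
by apply/andP; split; apply: lt0r_neq0 => //; exact: posdef_det_gt0.
Qed.

End GaussianIntegral.

(** * Likelihood ratios of shifted Gaussian noise *)

Section GaussianStep.
Context {R : realType}.

Section OneColumn.
Variables (n : nat) (Rm : 'M[R]_n).
Let Q := invmx Rm.

                                                                                   
(** The logarithm of the ratio of the density at [u + a] to the density at [u] ([gauss_pdf_add]),
    hence the privacy loss with opposite sign; the normalizing constant cancels. *)
Definition loglik (a u : n.-tuple R) : R :=
  (qform Q (cv_of_tuple u) - qform Q (cv_of_tuple (tuple_add a u))) / 2.

Lemma measurable_loglik a : measurable_fun setT (loglik a).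
Proof.
apply: measurable_funM => //; apply: measurable_funB; first exact: measurable_qform.
apply: (@measurableT_comp _ _ _ _ _ _ (fun u => qform Q (cv_of_tuple u))).
  exact: measurable_qform.
exact: measurable_tuple_add.
Qed.

Lemma gauss_pdfE u : gauss_pdf Rm u =
  (Num.sqrt ((pi *+ 2) ^+ n * \det Rm))^-1 * expR (- qform Q (cv_of_tuple u) / 2).
Proof. by []. Qed.

Lemma measurable_gauss_pdf : measurable_fun setT (gauss_pdf Rm).
Proof.
apply: measurable_funM => //; apply: measurableT_comp => //.
by apply: measurable_funM => //; apply: measurable_funN; exact: measurable_qform.
Qed.

Lemma gauss_pdf_ge0 u : 0 <= gauss_pdf Rm u.
Proof. by rewrite mulr_ge0 ?expR_ge0// invr_ge0 sqrtr_ge0. Qed.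

Lemma gauss_pdf_add a u :
  gauss_pdf Rm (tuple_add a u) = expR (loglik a u) * gauss_pdf Rm u.
Proof.
rewrite !gauss_pdfE mulrCA -expRD; congr (_ * expR _).
by rewrite /loglik; ring.
Qed.

Lemma is_integral_Igauss : is_integral (Igauss Rm).
Proof.
exact: (is_integral_density (is_integral_tint is_integral_Ileb n)
  measurable_gauss_pdf gauss_pdf_ge0).
Qed.

(** Change of measure: weight times density at [u] is the density at [u + a], and Lebesgue measure
    is translation invariant. *)
Lemma Igauss_add (a : n.-tuple R) (f : n.-tuple R -> \bar R) :
  measurable_fun setT f -> (forall u, 0 <= f u)%E ->
  Igauss Rm (fun u => (expR (loglik a u))%:E * f (tuple_add a u))%E =
  Igauss Rm f.
Proof.
move=> mf f0; rewrite /Igauss -[RHS](tint_Ileb_add a); last 2 first.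
- apply: emeasurable_funM => //; apply/measurable_EFinP.
  exact: measurable_gauss_pdf.
- by move=> u; rewrite mule_ge0// lee_fin gauss_pdf_ge0.
congr tint; apply/funext => u; rewrite gauss_pdf_add [in RHS]EFinM.
by rewrite [RHS]muleCA muleA.
Qed.

Lemma Igauss1 : posdef Rm -> Igauss Rm (fun=> 1%E) = 1%E.
Proof.
move=> pR; rewrite /Igauss; have det0 := posdef_det_gt0 pR.
have K0 : 0 < (pi *+ 2) ^+ n * \det Rm.
  by rewrite mulr_gt0// exprn_gt0// mulrn_wgt0// pi_gt0.
pose E (u : n.-tuple R) : \bar R := (expR (- qform Q (cv_of_tuple u) / 2))%:E.
have mE : measurable_fun [set: n.-tuple R] E by exact: measurable_expR_qform.
have E0 u : (0 <= E u)%E by rewrite lee_fin expR_ge0.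
transitivity (tint (@Ileb R) (fun u : n.-tuple R =>
    ((Num.sqrt ((pi *+ 2) ^+ n * \det Rm))^-1)%:E * E u)%E).
  by congr tint; apply/funext => u; rewrite mul1e gauss_pdfE.
rewrite (is_integralZ (is_integral_tint is_integral_Ileb n))//.
rewrite tint_gauss; last exact: posdef_invmx.
by rewrite det_inv invrK -EFinM mulVf// gt_eqF// sqrtr_gt0.
Qed.

(** [loglik] is affine in [u], with linear part linear in [a]. Its multiple by [- l] is therefore
    the log ratio for the shift [- l * a] up to a constant, which is an exponential tilting. *)
Lemma loglikN_scale l a u : posdef Rm ->
  - l * loglik a u = loglik [tuple - l * tnth a i | i < n] u +
                    (l + l ^+ 2) / 2 * qform Q (cv_of_tuple a).
Proof.
move=> pR; have Qs : Q^T = Q by apply: posdef_sym; exact: posdef_invmx.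
rewrite /loglik !cv_of_tuple_add !qformD//.
have -> : cv_of_tuple [tuple - l * tnth a i | i < n] = - l *: cv_of_tuple a.
  by apply/colP => i; rewrite mxE [RHS]mxE tnth_mktuple mxE.
have -> : ((cv_of_tuple u)^T *m Q *m (- l *: cv_of_tuple a)) 0 0 =
    - l * ((cv_of_tuple u)^T *m Q *m cv_of_tuple a) 0 0.
  by rewrite -scalemxAr mxE.
rewrite qformZ.
by field.
Qed.

End OneColumn.

Lemma tint_cst1 (X : Type) (I : (X -> \bar R) -> \bar R) N :
  I (fun=> 1%E) = 1%E -> tint I (fun _ : N.-tuple X => 1%E) = 1%E.
Proof.
by move=> I1; elim: N => //= N IH; rewrite -[RHS]I1; congr I; apply/funext.
Qed.

(** * Adaptive coupling of the noises and the Chernoff bound *)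

Variables (n d : nat) (Rm : 'M[R]_n).
Hypothesis Rm_pd : posdef Rm.
Local Notation X := (d.-tuple (n.-tuple R)).
Local Notation J := (@tint R _ (Igauss Rm) d).

Definition noise_add (a v : X) : X := tuple_shift (@tuple_add R n) a v.

Definition noise_loglik (a v : X) : R :=
  \sum_(k < d) loglik Rm (tnth a k) (tnth v k).

(** The squared Mahalanobis length of the shift, added up over the independent columns. *)
Definition noise_cost (a : X) : R :=
  \sum_(k < d) qform (invmx Rm) (cv_of_tuple (tnth a k)).

Lemma is_integral_noise : is_integral J.
Proof. exact: (is_integral_tint (is_integral_Igauss Rm) d). Qed.

Lemma measurable_noise_add a : measurable_fun setT (noise_add a).
Proof. by apply: measurable_tuple_shift => b; exact: measurable_tuple_add. Qed.

Lemma measurable_noise_loglik a : measurable_fun setT (noise_loglik a).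
Proof.
apply: measurable_sum => k.
apply: (measurableT_comp (measurable_loglik Rm (tnth a k))).
exact: measurable_tnth.
Qed.

Lemma noise_integral_add (a : X) (f : X -> \bar R) :
  measurable_fun setT f -> (forall u, 0 <= f u)%E ->
  J (fun v => (expR (noise_loglik a v))%:E * f (noise_add a v))%E = J f.
Proof.
move=> mf f0; rewrite -[RHS](tint_shift (sh := @tuple_add R n)
  (w := fun a u => expR (loglik Rm a u))
  (is_integral_Igauss Rm) _ _ _ _ a mf f0); first last.
- by move=> b g; exact: Igauss_add.
- by move=> b u; exact: expR_ge0.
- by move=> b; apply: measurableT_comp => //; exact: measurable_loglik.
- by move=> b; exact: measurable_tuple_add.
by congr tint; apply/funext => v; rewrite expR_sum.
Qed.

Lemma noise_integral_moment (l : R) (a : X) :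
  J (fun v => (expR (- l * noise_loglik a v))%:E) =
  (expR ((l + l ^+ 2) / 2 * noise_cost a))%:E.
Proof.
(* Tilting by [b] turns the integrand into a constant times a likelihood ratio, and the ratio
   integrates to 1. *)
pose b : X := [tuple [tuple - l * tnth (tnth a k) i | i < n] | k < d].
rewrite -[RHS]mule1 -[X in _ = (_ * X)%E](tint_cst1 d (Igauss1 Rm_pd)).
rewrite -[in RHS](noise_integral_add b)//.
rewrite -(is_integralZ is_integral_noise) ?expR_ge0//; first last.
- apply: emeasurable_funM => //; apply/measurable_EFinP.
  by apply: measurableT_comp => //; exact: measurable_noise_loglik.
congr tint; apply/funext => v; rewrite mule1 -EFinM -expRD; congr (expR _)%:E.
rewrite /noise_loglik /noise_cost !mulr_sumr -big_split; apply: eq_bigr => k _.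
by rewrite loglikN_scale// addrC tnth_mktuple.
Qed.

                                                                               
                                             
(** [F] and [F'] agree after shifting the noise nonanticipatively: [a] is chosen before [v], so it
    may depend on the earlier noises but not on the current one. This adaptivity is needed because
    the gradients depend on the current state. *)
Fixpoint coupled (B : R) N : (N.-tuple X -> \bar R) -> (N.-tuple X -> \bar R) -> Prop :=
  match N return (N.-tuple X -> \bar R) -> (N.-tuple X -> \bar R) -> Prop with
  | 0 => fun F F' => F [tuple] = F' [tuple]
  | N'.+1 => fun F F' => exists2 a : X, noise_cost a <= B &
      forall v, coupled B (fun t : N'.-tuple X => F (cons_tuple v t))
                          (fun t => F' (cons_tuple (noise_add a v) t))
  end.

Lemma eq_coupled (B : R) N (F F' G G' : N.-tuple X -> \bar R) :
  (forall z, F z = G z) -> (forall z, F' z = G' z) ->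
  coupled B F F' -> coupled B G G'.
Proof. by move=> /funext -> /funext ->. Qed.

                                                                                  
                                 
(** Chernoff bound by induction on the number of iterations. Quantifying over every real [c] lets
    the remaining privacy budget change with the noise already drawn, so the total adaptive loss
    never has to be defined. *)
Lemma coupled_le (B l : R) N (F F' : N.-tuple X -> \bar R) : 0 <= l ->
  measurable_fun setT F -> measurable_fun setT F' ->
  (forall z, 0 <= F z <= 1)%E -> (forall z, 0 <= F' z)%E ->
  coupled B F F' -> forall c : R,
  (tint J F <= (expR c)%:E * tint J F' +
     (expR (- l * c + N%:R * ((l + l ^+ 2) / 2 * B)))%:E)%E.
Proof.
move=> l0; elim: N => [|N IH] in F F' *.
  move=> _ _ F01 F'0 /= <- c; rewrite mul0r addr0.
  have /andP[F0 F1] := F01 [tuple].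
  (* With a nonnegative budget the first term suffices; with an exhausted one the error term is
     already at least 1. *)
  have [c0|c0] := leP 0 c.
    rewrite -[leLHS]adde0 leeD ?lee_fin ?expR_ge0//.
    by rewrite -[leLHS]mul1e lee_wpmul2r// lee_fin -expR0 ler_expR.
  apply: (@le_trans _ _ 1%E) => //; apply: lee_paddl.
    by rewrite mule_ge0// lee_fin expR_ge0.
  by rewrite lee_fin -expR0 ler_expR mulNr -mulrN mulr_ge0// oppr_ge0 ltW.
move=> mF mF' F01 F'0 [a aB cpl] c.
have F0 z : (0 <= F z)%E by have /andP[] := F01 z.
have II := is_integral_noise; have IN := is_integral_tint II N.
set K := (l + l ^+ 2) / 2 * B.
pose G v := tint J (fun t : N.-tuple X => F' (cons_tuple v t)).
have mG : measurable_fun setT G by exact: measurable_tint_cons.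
have G0 v : (0 <= G v)%E by exact: (is_integral_ge0 IN).
pose H1 v := ((expR (noise_loglik a v))%:E * G (noise_add a v))%E.
pose H2 v : \bar R := (expR (- l * noise_loglik a v))%:E.
have mH1 : measurable_fun setT H1.
  apply: emeasurable_funM.
    apply/measurable_EFinP; apply: measurableT_comp => //.
    exact: measurable_noise_loglik.
  by apply: (measurableT_comp mG); exact: measurable_noise_add.
have H10 v : (0 <= H1 v)%E by rewrite mule_ge0// lee_fin expR_ge0.
have mH2 : measurable_fun setT H2.
  apply/measurable_EFinP; apply: measurableT_comp => //.
  by apply: measurable_funM => //; exact: measurable_noise_loglik.
have H20 v : (0 <= H2 v)%E by rewrite lee_fin expR_ge0.
pose q := expR (- l * c + N%:R * K).
have q0 : 0 <= q by exact: expR_ge0.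
apply: (@le_trans _ _ (J (fun v => (expR c)%:E * H1 v + q%:E * H2 v)%E)).
  apply: (is_integral_le II).
  - exact: measurable_tint_cons.
  - by apply: emeasurable_funD; exact: emeasurable_funM.
  - by move=> v; exact: (is_integral_ge0 IN).
  (* The budget becomes [c + noise_loglik a v]: the first term acquires exactly the likelihood
     ratio, and the error term the factor whose integral is the moment of order [l]. *)
  - move=> v; have := IH _ _ (measurable_comp_cons1 v mF)
      (measurable_comp_cons1 (noise_add a v) mF')
      (fun t => F01 (cons_tuple v t)) (fun t => F'0 _) (cpl v)
      (c + noise_loglik a v).
    move=> /le_trans; apply; rewrite le_eqVlt; apply/orP; left; apply/eqP.
    rewrite /H1 /H2 /q -EFinM -expRD muleA -EFinM -expRD; congr (_ + (expR _)%:E)%E.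
    by rewrite /K; ring.
rewrite (is_integralD II); first last.
- by move=> v; rewrite mule_ge0.
- by move=> v; rewrite mule_ge0// lee_fin expR_ge0.
- exact: emeasurable_funM.
- exact: emeasurable_funM.
(* [H1] integrates to the integral of [F'] by change of measure; [H2] integrates to at most
   [expR K], which supplies the extra iteration in the exponent. *)
rewrite !(is_integralZ II) ?expR_ge0// noise_integral_add// noise_integral_moment.
rewrite leeD2l// -EFinM -expRD lee_fin ler_expR.
rewrite -[N.+1%:R]natr1 [(_ + 1) * K]mulrDl mul1r addrA lerD2l.
by rewrite /K ler_wpM2l// divr_ge0// addr_ge0// sqr_ge0.
Qed.

End GaussianStep.

(** * Norm bound and measurability of clipping *)

Section Clip.
Context {R : realType}.

Lemma enorm_sqr d (g : 'rV[R]_d) : enorm g ^+ 2 = \sum_(k < d) g 0 k ^+ 2.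
Proof. by rewrite sqr_sqrtr// sumr_ge0// => k _; exact: sqr_ge0. Qed.

Lemma clip_sqr_le (C : R) d (g : 'rV[R]_d) : 0 <= C ->
  \sum_(k < d) clip C g 0 k ^+ 2 <= C ^+ 2.
Proof.
move=> C0; set mu := Num.min 1 (C / enorm g).
have e0 : 0 <= enorm g by exact: sqrtr_ge0.
have mu0 : 0 <= mu by rewrite le_min ler01 divr_ge0.
have -> : \sum_(k < d) clip C g 0 k ^+ 2 = (mu * enorm g) ^+ 2.
  rewrite exprMn enorm_sqr mulr_sumr; apply: eq_bigr => k _.
  by rewrite mxE exprMn.
rewrite ler_sqr ?nnegrE ?mulr_ge0//.
have [->|en0] := eqVneq (enorm g) 0; first by rewrite mulr0.
by rewrite -ler_pdivlMr ?lt_def ?en0// ge_min lexx orbT.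
Qed.

Lemma measurable_clip (C : R) d dX (X : measurableType dX) (g : X -> 'rV[R]_d) k :
  (forall k, measurable_fun setT (fun x => g x 0 k)) ->
  measurable_fun setT (fun x => clip C (g x) 0 k).
Proof.
move=> mg.
have ms : measurable_fun setT (fun x => \sum_(k < d) g x 0 k ^+ 2).
  by apply: measurable_sum => i; exact: measurable_funX.
(* The inverse norm is written as a real power of the squared norm, a measurable function; both are
   0 at the zero gradient. *)
rewrite (_ : (fun x => _) = fun x => Num.min 1
    (C * (\sum_(k < d) g x 0 k ^+ 2) `^ (- 2^-1)) * g x 0 k).
  apply: measurable_funM => //; apply: measurable_minr => //.
  apply: measurable_funM => //.
  have mp : measurable_fun [set: R] (fun y : R => y `^ (- 2^-1)).
    exact: measurable_powR.
  exact: (measurableT_comp mp ms).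
apply/funext => x; rewrite mxE powRN powR12_sqrt//.
by apply: sumr_ge0 => i _; exact: sqr_ge0.
Qed.

End Clip.

(** * Measurability of the mechanism and coupling of neighboring runs *)

Section DSGD.
Context {R : realType} {n d T : nat} {Data : Type} {dx : measure_display}
  {Xi : measurableType dx}.
Variable grad : nat -> 'I_n -> Data -> Xi -> 'rV[R]_d -> 'rV[R]_d.
Hypothesis grad_meas : forall (t : nat) (i : 'I_n) (Di : Data),
  measurable_fun [set: Xi * d.-tuple R]
    (fun p : Xi * d.-tuple R => tuple_of_rv (grad t i Di p.1 (rv_of_tuple p.2))).
Variables (C : R) (W : 'M[R]_n) (eta : nat -> R) (x0 : 'M[R]_(n, d)).
Local Notation X := (d.-tuple (n.-tuple R)).
Implicit Types D : 'I_n -> Data.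

Section Measurability.

Lemma measurable_nth_tuple dX (X : measurableType dX) N (x : X) t :
  measurable_fun setT (fun z : N.-tuple X => nth x z t).
Proof.
have [tN|Nt] := ltnP t N.
  rewrite (_ : (fun z => _) = fun z : N.-tuple X => tnth z (Ordinal tN)).
    exact: measurable_tnth.
  by apply/funext => z; rewrite (tnth_nth x).
rewrite (_ : (fun z => _) = cst x); first exact: measurable_cst.
by apply/funext => z; rewrite nth_default ?size_tuple.
Qed.

Lemma tuple_of_rvK : cancel (@tuple_of_rv R d) (@rv_of_tuple R d).
Proof. by move=> x; apply/rowP => k; rewrite mxE tnth_mktuple. Qed.

Lemma measurable_dsgd_state D t i k :
  measurable_fun [set: Xi * T.-tuple X]
    (fun p => dsgd_state grad C W eta x0 D p.1 p.2 t i k).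
Proof.
elim: t => [|t IH] in i k *; first exact: measurable_cst.
rewrite /= /dsgd_step.
under eq_fun do rewrite mxE.
apply: measurable_sum => l; apply: measurable_funM => //.
under eq_fun do rewrite !mxE.
apply: measurable_funB; first exact: IH.
apply: measurable_funM => //; apply: measurable_funD.
  pose g (p : Xi * T.-tuple X) : 'rV[R]_d := grad t l (D l) p.1
    (row l (dsgd_state grad C W eta x0 D p.1 p.2 t)).
  rewrite (_ : (fun p => _) = fun p : Xi * T.-tuple X => clip C (g p) 0 k);
    last by apply/funext => p; rewrite mxE.
  apply: measurable_clip => {}k.
  have mx : measurable_fun [set: Xi * T.-tuple X] (fun p =>
      (p.1, tuple_of_rv (row l (dsgd_state grad C W eta x0 D p.1 p.2 t)))).
    apply: measurable_fun_pair => //; apply/measurable_fun_tnthP => j.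
    rewrite (_ : _ \o _ =
      fun p => dsgd_state grad C W eta x0 D p.1 p.2 t l j); first exact: IH.
    by apply/funext => p /=; rewrite tnth_mktuple mxE.
  have := measurableT_comp (grad_meas t l (D l)) mx.
  move=> /measurable_fun_tnthP/(_ k); congr measurable_fun.
  by apply/funext => p /=; rewrite tnth_mktuple tuple_of_rvK.
apply: (measurableT_comp (measurable_tnth l)).
apply: (measurableT_comp (measurable_tnth k)).
by apply: (measurableT_comp (measurable_nth_tuple _ _)).
Qed.

Lemma measurable_dsgd_output D :
  measurable_fun [set: Xi * T.-tuple X]
    (fun p => dsgd_output grad C W eta x0 D p.1 p.2).
Proof.
apply/measurable_fun_tnthP => t; apply/measurable_fun_tnthP => i.
apply/measurable_fun_tnthP => k.
rewrite (_ : _ \o _ =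
  fun p => dsgd_state grad C W eta x0 D p.1 p.2 t.+1 i k).
  exact: measurable_dsgd_state.
by apply/funext => p /=; rewrite !tnth_mktuple.
Qed.

End Measurability.

Section Coupling.
Variables (Rm : 'M[R]_n) (xi : Xi).
Hypothesis C_ge0 : 0 <= C.
Hypothesis Rm_pd : posdef Rm.

(** The same recursion on sequences of any length, so that a history and the noises still to come
    can be concatenated without casts between tuple types. *)
Fixpoint seq_state D (z : seq X) (t : nat) : 'M[R]_(n, d) :=
  if t is t'.+1 then
    dsgd_step grad C W eta D xi t' (seq_state D z t')
      (noise_mx (nth (noise0 R n d) z t'))
  else x0.

Lemma seq_stateE D (z : T.-tuple X) t :
  dsgd_state grad C W eta x0 D xi z t = seq_state D z t.
Proof. by elim: t => //= t ->. Qed.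

Lemma seq_state_cat D (p s : seq X) t : (t <= size p)%N ->
  seq_state D (p ++ s) t = seq_state D p t.
Proof. by elim: t => //= t IH tp; rewrite IH 1?ltnW// nth_cat tp. Qed.

Definition seq_output D (z : seq X) : T.-tuple (n.-tuple (d.-tuple R)) :=
  [tuple tuple_of_mx (seq_state D z t.+1) | t < T].

Lemma seq_outputE D (z : T.-tuple X) :
  dsgd_output grad C W eta x0 D xi z = seq_output D z.
Proof. by apply: eq_from_tnth => t; rewrite !tnth_mktuple seq_stateE. Qed.

(** What the noise of the [D'] run must gain to reproduce the step of the [D] run from the common
    state [x]; stored by columns, like the noise. *)
Definition grad_gap D D' t (x : 'M[R]_(n, d)) : X :=
  [tuple [tuple clip C (grad t i (D i) xi (row i x)) 0 k -
                clip C (grad t i (D' i) xi (row i x)) 0 k | i < n] | k < d].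

Lemma dsgd_step_gap D D' t x v :
  dsgd_step grad C W eta D xi t x (noise_mx v) =
  dsgd_step grad C W eta D' xi t x (noise_mx (noise_add (grad_gap D D' t x) v)).
Proof.
rewrite /dsgd_step; congr (_ *m (_ - _ *: _)); apply/matrixP => i k.
by rewrite !mxE !tnth_mktuple /clip !mxE; ring.
Qed.

(** Only row [j] is nonzero, so each column costs its squared [j]-th entry times [invmx Rm j j]. The
    factor 4 comes from bounding a squared difference by twice the sum of the squares, each sum
    being at most [C ^+ 2] after clipping. *)
Lemma noise_cost_gap D D' j t x : (forall i, i <> j -> D i = D' i) ->
  noise_cost Rm (grad_gap D D' t x) <= 4 * C ^+ 2 * invmx Rm j j.
Proof.
move=> DD'; pose g (E : 'I_n -> Data) := clip C (grad t j (E j) xi (row j x)).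
have Q0 : 0 <= invmx Rm j j by exact/ltW/posdef_diag_gt0/posdef_invmx.
have -> : noise_cost Rm (grad_gap D D' t x) =
    (\sum_(k < d) (g D 0 k - g D' 0 k) ^+ 2) * invmx Rm j j.
  rewrite /noise_cost mulr_suml; apply: eq_bigr => k _; rewrite -qform_delta.
  congr qform; apply/colP => i; rewrite mxE [RHS]mxE.
  rewrite !tnth_mktuple [delta_mx _ _ _ _]mxE eqxx andbT.
  have [->|/eqP ij] := eqVneq i j; first by rewrite mulr1.
  by rewrite mulr0 DD'// subrr.
apply: ler_wpM2r => //.
apply: (@le_trans _ _ (2 * \sum_(k < d) g D 0 k ^+ 2 + 2 * \sum_(k < d) g D' 0 k ^+ 2)).
  rewrite !mulr_sumr -big_split ler_sum// => k _ /=.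
  by have := sqr_ge0 (g D 0 k + g D' 0 k); nra.
have := @clip_sqr_le R C d (grad t j (D j) xi (row j x)) C_ge0.
have := @clip_sqr_le R C d (grad t j (D' j) xi (row j x)) C_ge0.
by rewrite -/(g D) -/(g D'); lra.
Qed.

(** Induction on the number of remaining iterations, the invariant being that the histories [p] and
    [p'] have led both runs through the same states. *)
Lemma coupled_seq_output D D' j (S : set (T.-tuple (n.-tuple (d.-tuple R)))) :
  (forall i, i <> j -> D i = D' i) ->
  forall N (p p' : seq X), size p = size p' -> (size p + N)%N = T ->
  (forall t, (t <= size p)%N -> seq_state D p t = seq_state D' p' t) ->
  coupled Rm (4 * C ^+ 2 * invmx Rm j j)
    (fun z : N.-tuple X => (\1_S (seq_output D (p ++ z)))%:E : \bar R)
    (fun z : N.-tuple X => (\1_S (seq_output D' (p' ++ z)))%:E).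
Proof.
move=> DD'; elim=> [|N IH] p p' pp' pT st /=.
  rewrite !cats0; congr (\1_S _)%:E; apply: eq_from_tnth => t.
  by rewrite !tnth_mktuple st// -(addn0 (size p)) pT.
set x := seq_state D p (size p).
exists (grad_gap D D' (size p) x); first exact: noise_cost_gap.
move=> v; set v' := noise_add _ v.
have := IH (rcons p v) (rcons p' v').
rewrite !size_rcons pp' addSnnS -pp' => /(_ erefl pT).
rewrite (_ : (fun z : N.-tuple X => _) =
  (fun t => (\1_S (seq_output D (p ++ v :: t)))%:E)); last first.
  by apply/funext => z; rewrite cat_rcons.
rewrite (_ : (fun z : N.-tuple X => (\1_S (seq_output D' _))%:E) =
  (fun t => (\1_S (seq_output D' (p' ++ v' :: t)))%:E)); last first.
  by apply/funext => z; rewrite cat_rcons.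
(* Earlier states depend only on the old histories; the newest one agrees by the choice of the
   gap. *)
apply => t; rewrite leq_eqVlt ltnS => /predU1P[->|tp]; last first.
  by rewrite -!cats1 !seq_state_cat -?pp'// st.
rewrite /= !nth_rcons -pp' ltnn eqxx -!cats1 !seq_state_cat -?pp'//.
by rewrite -st// -/x; exact: dsgd_step_gap.
Qed.

Lemma coupled_dsgd D D' j (S : set (T.-tuple (n.-tuple (d.-tuple R)))) :
  (forall i, i <> j -> D i = D' i) ->
  coupled Rm (4 * C ^+ 2 * invmx Rm j j)
    (fun z : T.-tuple X => (\1_S (dsgd_output grad C W eta x0 D xi z))%:E : \bar R)
    (fun z => (\1_S (dsgd_output grad C W eta x0 D' xi z))%:E).
Proof.
move=> DD'; apply: (eq_coupled _ _
  (@coupled_seq_output D D' j S DD' T [::] [::] erefl erefl _)).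
- by move=> z; rewrite seq_outputE.
- by move=> z; rewrite seq_outputE.
- by move=> t; rewrite leqn0 => /eqP->.
Qed.

End Coupling.
End DSGD.

(** * Choice of the Chernoff parameter and conclusion *)

Section Privacy.
Context {R : realType}.

(** The left side is quadratic in [l] and is minimized at the square root of [ln (1 / delta) / rho],
    where the terms linear in [rho] cancel. *)
Lemma chernoff_exponent (rho delta : R) : 0 < rho -> 0 < delta < 1 ->
  exists2 l : R, 0 <= l &
    - l * (rho + 2 * Num.sqrt (rho * ln (1 / delta))) + rho * (l + l ^+ 2) =
    ln delta.
Proof.
move=> rho0 /andP[d0 d1].
have L0 : 0 <= ln (1 / delta) by rewrite ln_ge0// div1r invf_ge1// ltW.
have -> : ln delta = - ln (1 / delta) by rewrite div1r lnV ?posrE// opprK.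
rewrite sqrtrM ?(ltW rho0)//.
have r0 : 0 < Num.sqrt rho by rewrite sqrtr_gt0.
exists (Num.sqrt (ln (1 / delta)) / Num.sqrt rho); first by rewrite divr_ge0 ?sqrtr_ge0.
have := sqr_sqrtr L0; have := sqr_sqrtr (ltW rho0).
move: (Num.sqrt rho) (Num.sqrt (ln _)) r0 => r s r0 <- <-.
by field; rewrite gt_eqF.
Qed.

Lemma max_diag_inv_ge n (Rm : 'M[R]_n) j : invmx Rm j j <= max_diag_inv Rm.
Proof. exact: (le_bigmax 0 (fun i => invmx Rm i i) j). Qed.

End Privacy.

Unset Implicit Arguments.

Theorem theorem2 (R : realType) (n d T : nat) (Data : Type)
  (dx : measure_display) (Xi : measurableType dx) (P : probability Xi R)
  (grad : nat -> 'I_n -> Data -> Xi -> 'rV[R]_d -> 'rV[R]_d)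
  (grad_meas : forall (t : nat) (i : 'I_n) (Di : Data),
     measurable_fun [set: Xi * d.-tuple R]
       (fun p : Xi * d.-tuple R => tuple_of_rv (grad t i Di p.1 (rv_of_tuple p.2))))
  (C : R) (C_gt0 : 0 < C) (W : 'M[R]_n) (eta : nat -> R) (x0 : 'M[R]_(n, d))
  (Rm : 'M[R]_n) (Rm_pd : posdef Rm) (delta : R) (delta_in : 0 < delta < 1) :
  agent_level_DP
    (@dsgd_prob R n d T Data dx Xi P grad C W eta x0 Rm)
    (2 * C ^+ 2 * T%:R * max_diag_inv Rm
     + 2 * C * Num.sqrt (2 * T%:R * ln (1 / delta) * max_diag_inv Rm))
    delta.
Proof.
move=> D D' [j [_ DD']] S mS; have /andP[delta0 delta1] := delta_in.
set m := max_diag_inv Rm; set eps := (X in expR X).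
pose J := @tint R _ (Igauss Rm) d.
pose F (E : 'I_n -> Data) (p : Xi * T.-tuple (d.-tuple (n.-tuple R))) : \bar R :=
  (\1_S (dsgd_output grad C W eta x0 E p.1 p.2))%:E.
have mF E : measurable_fun setT (F E).
  apply/measurable_EFinP; apply: measurableT_comp; first exact: measurable_indic.
  exact: measurable_dsgd_output.
have F0 E p : (0 <= F E p)%E by rewrite lee_fin.
have IJ : is_integral (fun f => @tint R _ J T f).
  exact: is_integral_tint (is_integral_noise d Rm) T.
pose A E xi := tint J (fun z => F E (xi, z)).
have mA E : measurable_fun setT (A E) by exact: (measurable_is_integral IJ).
have A0 E xi : (0 <= A E xi)%E by exact: (is_integral_ge0 IJ).
suff key xi : (A D xi <= (expR eps)%:E * A D' xi + delta%:E)%E.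
  rewrite /dsgd_prob -/J -[X in (X <= _)%E]/(\int[P]_xi A D xi)%E.
  rewrite -[X in (_ * X)%E]/(\int[P]_xi A D' xi)%E.
  apply: (@le_trans _ _ (\int[P]_xi ((expR eps)%:E * A D' xi + delta%:E))%E).
    apply: ge0_le_integral => //.
    by apply: emeasurable_funD => //; exact: emeasurable_funM.
  rewrite ge0_integralD//; last 3 first.
  - by move=> xi _; rewrite mule_ge0// lee_fin expR_ge0.
  - exact: emeasurable_funM.
  - by move=> xi _; rewrite lee_fin ltW.
  rewrite ge0_integralZl_EFin ?expR_ge0// integral_cst//.
  rewrite leeD2l// -[leRHS]mule1 lee_wpmul2l ?lee_fin ?(ltW delta0)//.
  exact: probability_le1.
(* For [T = 0] the value [rho] would be 0 and the choice of [l] would fail, but then the output is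
   the empty tuple for both collections. *)
case: (posnP T) => [T0|T_gt0].
  have -> : A D xi = A D' xi.
    congr tint; apply/funext => z; congr (\1_S _)%:E.
    by apply: eq_from_tnth => -[t tT]; exfalso; move: (tT); rewrite T0.
  have -> : eps = 0 by rewrite /eps T0 !(mulr0, mul0r) sqrtr0 mulr0 addr0.
  by rewrite expR0 mul1e -[X in (X <= _)%E]adde0 leeD2l// lee_fin ltW.
have Qjj : 0 < invmx Rm j j by exact/posdef_diag_gt0/posdef_invmx.
have m0 : 0 < m by apply: lt_le_trans Qjj _; exact: max_diag_inv_ge.
pose rho := 2 * C ^+ 2 * T%:R * m.
have rho0 : 0 < rho by rewrite !mulr_gt0 ?exprn_gt0 ?ltr0n.
have [l l0 lE] := chernoff_exponent rho0 delta_in.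
(* [C] is moved under the square root as [C ^+ 2], which exhibits [rho] there. *)
have epsE : eps = rho + 2 * Num.sqrt (rho * ln (1 / delta)).
  rewrite /eps -/rho; congr (_ + _); rewrite -mulrA; congr (_ * _).
  rewrite -[in LHS](ger0_norm (ltW C_gt0)) -sqrtr_sqr -sqrtrM ?sqr_ge0//.
  by congr Num.sqrt; rewrite /rho; ring.
have mFxi E : measurable_fun setT (fun z => F E (xi, z)).
  exact: (measurableT_comp (mF E) (pair1_measurable xi)).
have F01 z : (0 <= F D (xi, z) <= 1)%E.
  by rewrite F0 lee_fin /= indicE lern1; case: (_ \in _).
have cpl := coupled_dsgd grad W eta x0 xi (ltW C_gt0) Rm_pd S DD'.
apply: le_trans (coupled_le Rm_pd l0 (mFxi D) (mFxi D') F01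
  (fun z => F0 D' (xi, z)) cpl eps) _.
rewrite leeD2l// lee_fin -[leRHS]lnK ?posrE// ler_expR -lE epsE lerD2l.
(* [rho * (l + l ^+ 2)] is the exponent of [coupled_le] with [invmx Rm j j] replaced by its upper
   bound [m]. *)
rewrite (_ : rho * _ = T%:R * ((l + l ^+ 2) / 2 * (4 * C ^+ 2 * m))); last first.
  by rewrite /rho; field.
rewrite ler_wpM2l// ler_wpM2l ?divr_ge0 ?addr_ge0 ?sqr_ge0//.
apply: ler_wpM2l; first by rewrite mulr_ge0 ?sqr_ge0.
exact: max_diag_inv_ge.
Qed.
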